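(* Let $p$ be an odd prime, $n$ a positive integer, and $\omega$ a unit modulo $pn$, with residues $\omega_p$ mod $p$ and $\omega_n$ mod $n$. Suppose that $\operatorname{ord}(\omega_n)=uv$ with $u,v$ positive integers, $u$ even, $v$ odd, and $\gcd(v,\operatorname{ord}(\omega_p))=1$. Let $r$ be a positive integer, and suppose further that $\omega_n^{uv/2}=-1$ in $\mathbb{Z}/n\mathbb{Z}$ and that $\operatorname{ord}(\omega_p)=\frac{1}{r}\phi(p)$. Let $s,t$ be integers with $\gcd(t,p)=1$. (a) If $p\equiv 1\pmod{2ru}$, then $$\sigma_\omega(sp+tn)=\frac{2}{ru}\sum_{j=1}^{u/2}\begin{pmatrix} g_{ru/2}(\omega^j t)-1&0\\ 0&g_{ru}(\omega^j t)-g_{ru/2}(\omega^j t)\end{pmatrix}\sigma_{\omega_n^u}(\omega^j s).$$ (b) If $4\mid u$ and $p\equiv 1+\frac{ru}{2}\pmod{ru}$, then $$\sigma_\omega(sp+tn)=\frac{4}{ru}\sum_{j=1}^{u/2}\begin{pmatrix} \Re(g_{ru/2}(\omega^j t))-1&0\\ \Im(g_{ru/2}(\omega^j t))&0\end{pmatrix}\sigma_{\omega_n^u}(\omega^j s).$$ Here $\sigma_\omega$ is the cyclic supercharacter mod $pn$ associated to $\omega$, and $\sigma_{\omega_n^u}$ is the cyclic supercharacter mod $n$ associated to $\omega_n^u$.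
   Context: Write $e(\theta)=\exp(2\pi i\theta)$ for real $\theta$, and let $\phi$ be Euler's totient function. For a positive integer $N$ and a unit $\omega$ mod $N$ of multiplicative order $d=\operatorname{ord}(\omega)$, the cyclic supercharacter mod $N$ associated to $\omega$ is $\sigma_\omega:\mathbb{Z}/N\mathbb{Z}\to\mathbb{C}$, $\sigma_\omega(y)=\sum_{j=1}^{d} e\left(\frac{\omega^j y}{N}\right)$, also regarded as a function on $\mathbb{Z}$ of period $N$. Integers are treated as residues where appropriate (the argument $\omega^j s$ is reduced mod $n$, the argument $\omega^j t$ mod $p$). For a positive divisor $k$ of $\phi(p)$, the Gauss sum $g_k:(\mathbb{Z}/p\mathbb{Z})^\times\to\mathbb{C}$ is $g_k(t)=\sum_{j=1}^{p} e\left(\frac{tj^k}{p}\right)$. $\mathbb{C}$ is identified with $\mathbb{R}^2$ via the basis $(1,i)$, so a $2\times 2$ matrix acts on $z\in\mathbb{C}$ by $\begin{pmatrix}a&b\\c&d\end{pmatrix}z=(a\,\Re z+b\,\Im z)+i(c\,\Re z+d\,\Im z)$. *)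

(* Defs.v *)
From HB Require Import structures.
From mathcomp Require Import all_boot all_order all_algebra cyclic.
From mathcomp Require Import all_classical all_reals all_analysis.
From mathcomp Require Import complex.

Set Implicit Arguments.
Unset Strict Implicit.
Unset Printing Implicit Defensive.

Import Order.TTheory GRing.Theory Num.Theory.

Local Open Scope ring_scope.
Local Open Scope complex_scope.

(* Residues mod N are represented by integers; every notion below depends only
   on the residue class. This avoids 'Z_N, which is not Z/NZ when N = 1. *)

(* The least d in {1, ..., N} with w ^+ d = 1 mod N; it exists when w is a unit
   mod N and N > 0 (see [ordmodP]), and otherwise the value is meaningless. *)
Definition ordmod (N : nat) (w : int) : nat :=
  (find (fun d : nat => (w ^+ d == 1 %[mod N])%Z) (iota 1 N)).+1.

Lemma ordmodP (N : nat) (w : int) : (0 < N)%N -> coprimez w N ->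
  [/\ (0 < ordmod N w)%N, (w ^+ ordmod N w = 1 %[mod N])%Z
    & forall d : nat, (0 < d)%N -> (w ^+ d = 1 %[mod N])%Z ->
        (ordmod N w <= d)%N].
Proof.
move=> N0 cwN; rewrite /ordmod; set P := fun d : nat => _.
have hasP : has P (iota 1 N).
  apply/hasP; exists (totient N).
    rewrite mem_iota totient_gt0 N0 add1n ltnS totient_count_coprime.
    rewrite -[leqRHS]subn0 -[leqRHS]muln1 -sum_nat_const_nat.
    by apply: leq_sum => i _; case: coprime.
  rewrite /P -modzXm; have NZ0 : (N : int) != 0 by rewrite gt_eqF.
  have := modz_ge0 w NZ0.
  have : coprimez (w %% N)%Z N by rewrite /coprimez gcdz_modl.
  case: (w %% N)%Z => // a ca _.
  by rewrite -[Posz a]natz -natrX natz !modz_nat Euler_exp_totient.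
have fl : (find P (iota 1 N) < N)%N by rewrite -{2}(size_iota 1 N) -has_find.
split=> //.
- have := nth_find 0%N hasP; rewrite nth_iota // add1n => /eqP; exact.
- case=> // d _ wd; rewrite ltnS leqNgt; apply/negP => df.
  have := before_find 0%N df.
  by rewrite nth_iota ?(ltn_trans df)// add1n /P wd eqxx.
Qed.

Definition cexp (R : realType) (z : R[i]) : R[i] :=
  (expR (complex.Re z))%:C * (cos (complex.Im z) +i* sin (complex.Im z)).

Definition e (R : realType) (theta : R) : R[i] :=
  cexp (2 * pi%:C * 'i%C * theta%:C).

Definition supercharacter (R : realType) (N : nat) (w y : int) : R[i] :=
  \sum_(1 <= j < (ordmod N w).+1) e ((w ^+ j * y)%:~R / N%:R : R).

Definition gauss (R : realType) (p k : nat) (t : int) : R[i] :=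
  \sum_(1 <= j < p.+1) e ((t * j%:Z ^+ k)%:~R / p%:R : R).

Definition mx2 (T : Type) (a b c d : T) : 'M[T]_2 :=
  \matrix_(i < 2, j < 2)
    if i == 0 then (if j == 0 then a else b) else (if j == 0 then c else d).

(* The action of a 2 x 2 matrix on C identified with R^2 by the basis (1, 'i).
   Entries lie in R[i] because Gauss sums do; for entries in R this is the
   usual R-linear action. *)
Definition mxact (R : realType) (A : 'M[R[i]]_2) (z : R[i]) : R[i] :=
  (A 0 0 * (complex.Re z)%:C + A 0 1 * (complex.Im z)%:C)
  + 'i%C * (A 1 0 * (complex.Re z)%:C + A 1 1 * (complex.Im z)%:C).

(* Main.v *)
Require Import Defs.
From HB Require Import structures.
From mathcomp Require Import all_boot all_order all_algebra.
From mathcomp Require Import all_classical all_reals all_analysis.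
From mathcomp Require Import complex.
From mathcomp Require Import cyclic finfield.
From mathcomp Require Import ring.

(** Every summand of the supercharacter factors: with chi_N(y) = e(y / N),
    chi_{pn}(c (s p + t n)) = chi_n(c s) chi_p(c t) for every integer c
    ([add_char_crt]). So sigma_w(s p + t n) is the sum over i of
    chi_n(w^i s) chi_p(w^i t), whose two factors are periodic in i with periods
    ord_n(w) and ord_p(w). Write these orders as a b and a k with b and k
    coprime, and sort the i by their residue j mod a. On each class the factors
    have the coprime periods b and k, so the sum over the class is the product
    of the two sums taken separately ([supercharacter_mul]):
      sigma_w(s p + t n) = sum_{j=1}^{a} sigma_{w^a mod n}(w^j s)
                                         sigma_{w^a mod p}(w^j t).

    The second factor is a Gauss sum: if h has order k mod p and p - 1 = K k,
    then x -> x^K maps the nonzero residues onto the powers of h, K to one, and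
    g_K(t) = 1 + K sigma_h(t) ([gauss_supercharacter]). Since
    p - 1 = r ord_p(w), here K = r a.

    Write u = 2h. Since v is odd and w^{hv} = -1 mod n, multiplying by w^h acts
    on the orbits of <w^u> mod n like -1, so sigma_{w^u}(w^h y) is the complex
    conjugate of sigma_{w^u}(y) ([supercharacter_half_order]).

    In case (a), 2u divides ord_p(w) and a = u works, with b = v. The terms j
    and j + h have conjugate first factors, and their second factors add up to
    sigma_{w^h mod p}(w^j t), that is, to a Gauss sum of exponent r h: this is
    the diagonal matrix. In case (b), ord_p(w) is an odd multiple of h and a = h
    works, with b = 2v. The first factor is then
    sigma_{w^u} + conj(sigma_{w^u}) = 2 Re sigma_{w^u}, which is why the matrix
    has a zero second column.

    The factorization needs p and n coprime, and this follows from the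
    hypotheses: if p divided n, then w^{hv} = -1 would hold mod p too, and
    ord_p(w), being coprime to v, would divide 2h but not h. Hence ord_p(w) / h,
    an integer in both cases, would be 2 ([coprime_of_half_order]); but it is a
    multiple of 4 in case (a), and odd in case (b). *)

Set Implicit Arguments.
Unset Strict Implicit.
Unset Printing Implicit Defensive.

Import Order.TTheory GRing.Theory Num.Theory.

Local Open Scope ring_scope.
Local Open Scope complex_scope.

(** * Sums of periodic sequences *)

Lemma periodic_modn (T : Type) (D : nat) (F : nat -> T) :
  (forall i, F (i + D)%N = F i) -> forall i, F (i %% D)%N = F i.
Proof.
move=> FD i; rewrite [in RHS](divn_eq i D) addnC.
elim: (i %/ D)%N => [|q IHq]; first by rewrite mul0n addn0.
by rewrite mulSn [(D + _)%N]addnC addnA FD.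
Qed.

(** Multiplication by a unit followed by a translation permutes the residues
    mod D. *)
Lemma sum_periodic_progression (V : nmodType) (D a c : nat) (F : nat -> V) :
  (forall i, F (i + D)%N = F i) -> coprime a D ->
  \sum_(0 <= i < D) F (c + a * i)%N = \sum_(0 <= i < D) F i.
Proof.
move=> FD aD; case: D => [|D] in FD aD *; first by rewrite !big_geq.
rewrite !big_mkord.
pose h (i : 'I_D.+1) : 'I_D.+1 := inord ((c + a * i) %% D.+1)%N.
have hE i : h i = ((c + a * i) %% D.+1)%N :> nat.
  by rewrite inordK // ltn_pmod.
have h_inj : injective h.
  move=> i j /(congr1 val)/eqP; rewrite /= !hE eqn_modDl.
  wlog le_ij : i j / (i <= j)%N => [wlg|].
    case/orP: (leq_total i j) => le_ij; first exact: wlg.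
    by rewrite eq_sym => /wlg-> //.
  rewrite eq_sym eqn_mod_dvd ?leq_mul2l ?le_ij ?orbT // -mulnBr.
  rewrite Gauss_dvdr; last by rewrite coprime_sym.
  move=> dvd; apply/val_inj/eqP; rewrite eqn_leq le_ij /= -subn_eq0.
  apply: contraTT dvd => nz; rewrite gtnNdvd ?lt0n //.
  by rewrite (leq_ltn_trans (leq_subr _ _)).
rewrite [RHS](reindex_inj h_inj) /=; apply: eq_bigr => i _.
by rewrite hE (periodic_modn FD).
Qed.

Lemma sum_periodic_shift (V : nmodType) (D c : nat) (F : nat -> V) :
  (forall i, F (i + D)%N = F i) ->
  \sum_(0 <= i < D) F (c + i)%N = \sum_(0 <= i < D) F i.
Proof.
move=> FD; rewrite -(sum_periodic_progression c FD (coprime1n D)).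
by apply: eq_bigr => i _; rewrite mul1n.
Qed.

Lemma sum_by_residue (V : nmodType) (a b : nat) (F : nat -> V) :
  \sum_(0 <= i < a * b) F i =
  \sum_(0 <= j < a) \sum_(0 <= m < b) F (j + a * m)%N.
Proof.
rewrite mulnC big_nat_mul exchange_big /=; apply: eq_bigr => m _.
rewrite -{1}[(m * a)%N]add0n big_addn mulSn addnK.
by apply: eq_bigr => j _; rewrite [(m * a)%N]mulnC.
Qed.

(** Inside the class i mod b, the indices i + b m run over all residues mod k,
    because b is a unit mod k; F is constant there and G sums to its full
    period. *)
Lemma sum_periodic_mul (A : pzSemiRingType) (b k : nat) (F G : nat -> A) :
  coprime b k ->
  (forall i, F (i + b)%N = F i) -> (forall i, G (i + k)%N = G i) ->
  \sum_(0 <= i < b * k) F i * G i =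
  (\sum_(0 <= i < b) F i) * (\sum_(0 <= i < k) G i).
Proof.
move=> bk Fb Gk; rewrite sum_by_residue mulr_suml; apply: eq_bigr => i _.
rewrite -(sum_periodic_progression i Gk bk) mulr_sumr; apply: eq_bigr => m _.
congr (_ * _).
by rewrite -(periodic_modn Fb) [(b * m)%N]mulnC addnC modnMDl periodic_modn.
Qed.

(** * Powers in a finite field *)

Lemma expf_card_pred (F : finFieldType) (x : F) :
  x != 0 -> x ^+ #|F|.-1 = 1.
Proof.
move=> nzx; apply: (mulfI nzx); rewrite mulr1 -exprS prednK ?expf_card //.
by rewrite ltnW ?finNzRing_gt1.
Qed.

Lemma card_finField_pred_gt0 (F : finFieldType) : (0 < #|F|.-1)%N.
Proof. by rewrite -subn1 subn_gt0 finNzRing_gt1. Qed.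

Lemma finField_prim_root (F : finFieldType) :
  exists z : F, #|F|.-1.-primitive_root z.
Proof.
suff /hasP[z _ zP] : has #|F|.-1.-primitive_root (enum (predC1 (0 : F))).
  by exists z.
apply: has_prim_root; rewrite ?enum_uniq ?card_finField_pred_gt0 //.
  apply/allP => x; rewrite mem_enum => nzx; apply/unity_rootP.
  exact: expf_card_pred.
by rewrite -cardE (cardC1 (0 : F)).
Qed.

(** Both sides run over all powers of z. *)
Lemma sum_prim_root_powers (F : idomainType) (V : nmodType) (k c : nat) (z : F)
  (f : F -> V) : k.-primitive_root z -> coprime c k ->
  \sum_(0 <= l < k) f ((z ^+ c) ^+ l) = \sum_(0 <= l < k) f (z ^+ l).
Proof.
move=> kz ck.
rewrite -[RHS](@sum_periodic_progression _ k c 0) //; last first.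
  by move=> i; rewrite exprD (prim_expr_order kz) mulr1.
by apply: eq_bigr => l _; rewrite add0n exprM.
Qed.

Lemma sum_finField_units (F : finFieldType) (V : nmodType) (z : F)
  (f : F -> V) : #|F|.-1.-primitive_root z ->
  \sum_(x : F | x != 0) f x = \sum_(0 <= i < #|F|.-1) f (z ^+ i).
Proof.
move=> zP; pose h (i : 'I_#|F|.-1) := z ^+ i.
have h_inj : injective h.
  move=> i j /eqP; rewrite (eq_prim_root_expr zP) !modn_small // => /eqP.
  exact: val_inj.
rewrite big_mkord -(big_imset (h := h) _ (in2W h_inj)); apply: eq_bigl => x.
apply/idP/imsetP => [nzx|[i _ ->]].
  by have [i ->] := prim_rootP zP (expf_card_pred nzx); exists i.
by rewrite expf_neq0 // (prim_root_eq0 zP) -lt0n card_finField_pred_gt0.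
Qed.

(** Raising to the power K is K-to-one from the units onto the subgroup of
    order k, which h generates. In terms of a generator z of the units, the
    sequence f (z ^ (K i)) is k-periodic in i and is summed over K periods. *)
Lemma sum_finField_powers (F : finFieldType) (V : nmodType) (K k : nat) (h : F)
  (f : F -> V) : #|F|.-1 = (K * k)%N -> k.-primitive_root h ->
  \sum_(x : F | x != 0) f (x ^+ K) = (\sum_(0 <= l < k) f (h ^+ l)) *+ K.
Proof.
move=> FKk kh; have [z zP] := finField_prim_root F.
have /andP[_ k_gt0] : (0 < K)%N && (0 < k)%N.
  by rewrite -muln_gt0 -FKk card_finField_pred_gt0.
have zK : k.-primitive_root (z ^+ K).
  have /(dvdn_prim_root zP) : (k %| #|F|.-1)%N by rewrite FKk dvdn_mull.
  by rewrite FKk mulnK.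
have [c hE] := prim_rootP zK (prim_expr_order kh).
(* h need not be z ^ K itself, only another generator of the same subgroup. *)
have ck : coprime c k by rewrite -(prim_root_exp_coprime _ zK) -hE.
rewrite hE (sum_prim_root_powers f zK ck).
rewrite (sum_finField_units (fun x => f (x ^+ K)) zP) FKk mulnC sum_by_residue.
rewrite exchange_big /= -[X in _ *+ X]subn0 -sumr_const_nat.
apply: eq_bigr => m _; apply: eq_bigr => i _; rewrite -exprM.
have -> : ((i + k * m) * K = K * i + K * k * m)%N by ring.
by rewrite -exprM exprD -FKk [z ^+ (_ * m)]exprM (prim_expr_order zP) expr1n
  mulr1.
Qed.

(** * Multiplicative orders *)

Section MultiplicativeOrder.
Variables (N : nat) (w : int).
Hypotheses (N_gt0 : (0 < N)%N) (wN : coprimez w N).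

Lemma ordmod_gt0 : (0 < ordmod N w)%N.
Proof. by have [] := ordmodP N_gt0 wN. Qed.

Lemma expz_ordmod : (w ^+ ordmod N w = 1 %[mod N])%Z.
Proof. by have [] := ordmodP N_gt0 wN. Qed.

Lemma expzD_ordmod m : (w ^+ (m + ordmod N w) = w ^+ m %[mod N])%Z.
Proof. by rewrite exprD -modzMmr expz_ordmod modzMmr mulr1. Qed.

Lemma ordmod_dvdn m : (ordmod N w %| m)%N = (w ^+ m == 1 %[mod N])%Z.
Proof.
have [d_gt0 wd d_min] := ordmodP N_gt0 wN.
set d := ordmod N w in d_gt0 wd d_min *.
have -> : (w ^+ m = w ^+ (m %% d) %[mod N])%Z.
  rewrite (periodic_modn (F := fun i => (w ^+ i %% N)%Z)) //.
  exact: expzD_ordmod.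
apply/idP/eqP => [/eqP-> // | wm].
rewrite /dvdn; case: posnP => // m_gt0.
by have := d_min _ m_gt0 wm; rewrite leqNgt ltn_pmod.
Qed.

Lemma coprimezX a : coprimez (w ^+ a) N.
Proof. by apply: coprimezXl. Qed.

End MultiplicativeOrder.

Lemma eq_ordmod (N : nat) (w w' : int) :
  (w = w' %[mod N])%Z -> ordmod N w = ordmod N w'.
Proof.
move=> ww'; rewrite /ordmod; congr _.+1; apply: eq_find => d.
by rewrite -modzXm ww' modzXm.
Qed.

Lemma ordmod_unique (N d : nat) (w : int) : (0 < N)%N -> coprimez w N ->
  (forall m, (w ^+ m == 1 %[mod N])%Z = (d %| m)%N) -> ordmod N w = d.
Proof.
move=> N_gt0 wN dP; apply/eqP.
by rewrite eqn_dvd ordmod_dvdn // dP dvdnn -dP -ordmod_dvdn /=.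
Qed.

Lemma ordmodX (N a b : nat) (w : int) : (0 < N)%N -> coprimez w N ->
  (0 < a)%N -> ordmod N w = (a * b)%N -> ordmod N (w ^+ a) = b.
Proof.
move=> N_gt0 wN a_gt0 wab; apply: ordmod_unique; rewrite ?coprimezX // => m.
by rewrite -exprM -ordmod_dvdn // wab dvdn_pmul2l.
Qed.

Lemma ordmod_lcm (p n : nat) (w : int) : (0 < p)%N -> (0 < n)%N ->
  coprime p n -> coprimez w (p * n)%N ->
  ordmod (p * n) w = lcmn (ordmod p w) (ordmod n w).
Proof.
move=> p_gt0 n_gt0 pn; rewrite PoszM coprimezMr => /andP[wp wn].
apply: ordmod_unique => [||m]; rewrite ?muln_gt0 ?p_gt0 //.
  by rewrite PoszM coprimezMr wp.
by rewrite PoszM zchinese_remainder // dvdn_lcm !ordmod_dvdn.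
Qed.

(** * Additive characters modulo N *)

Section Character.
Variable R : realType.

Lemma eE (x : R) : e x = cos (2 * pi * x) +i* sin (2 * pi * x).
Proof.
rewrite /e.
have -> : 2 * pi%:C * 'i%C * x%:C = 0 +i* (2 * pi * x) :> R[i].
  rewrite -(rmorph_nat (real_complex R)) -!rmorphM /=.
  apply/eqP; rewrite eq_complex /=.
  by rewrite !(mul0r, mulr0, mulr1, mul1r, subr0, addr0, add0r, oppr0) !eqxx.
by rewrite /cexp /= expR0 mul1r.
Qed.

Lemma eD (x y : R) : e (x + y) = e x * e y.
Proof.
rewrite !eE mulrDr cosD sinD; apply/eqP; rewrite eq_complex /= eqxx /=.
by rewrite addrC [_ * sin _]mulrC.
Qed.

Lemma e0 : e (0 : R) = 1.
Proof. by rewrite eE mulr0 cos0 sin0. Qed.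

Lemma e1 : e (1 : R) = 1.
Proof. by rewrite eE mulr1 mulr_natl cos2pi sin2pi. Qed.

Lemma eN (x : R) : e (- x) = (e x)^*.
Proof. by rewrite !eE mulrN cosN sinN. Qed.

Lemma e_int (m : int) : e (m%:~R : R) = 1.
Proof.
have e_nat (k : nat) : e (k%:R : R) = 1.
  by elim: k => [|k IHk]; rewrite ?e0 // mulrS eD e1 IHk mulr1.
case: m => k; first exact: e_nat.
by rewrite NegzE mulrNz eN e_nat conjc1.
Qed.

Definition add_char (N : nat) (y : int) : R[i] := e (y%:~R / N%:R : R).

Lemma add_charN N y : add_char N (- y) = (add_char N y)^*.
Proof. by rewrite /add_char mulrNz mulNr eN. Qed.

Lemma eq_add_char N x y :
  (0 < N)%N -> (x = y %[mod N])%Z -> add_char N x = add_char N y.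
Proof.
move=> N_gt0 /eqP; rewrite eqz_mod_dvd => /dvdzP[q /(canRL (subrK _)) ->].
rewrite /add_char intrD mulrDl eD intrM.
by rewrite -[(N : int)%:~R]/(N%:R) mulfK ?pnatr_eq0 -?lt0n // e_int mul1r.
Qed.

(** c (s p + t n) / (p n) = c s / n + c t / p. *)
Lemma add_char_crt p n (s t c : int) : (0 < p)%N -> (0 < n)%N ->
  add_char (p * n) (c * (s * p%:Z + t * n%:Z)) =
  add_char n (c * s) * add_char p (c * t).
Proof.
move=> p_gt0 n_gt0; rewrite /add_char -eD; congr e.
rewrite !(intrM, intrD) natrM -!pmulrn.
have p0 : p%:R != 0 :> R by rewrite pnatr_eq0 -lt0n.
have n0 : n%:R != 0 :> R by rewrite pnatr_eq0 -lt0n.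
by field; rewrite p0 n0.
Qed.

End Character.

(** * Cyclic supercharacters *)

Section Supercharacter.
Variable R : realType.
Local Notation add_char := (add_char R).
Local Notation supercharacter := (supercharacter R).

(** The terms have period ord(w) in the exponent, so the summation may start
    anywhere. *)
Lemma supercharacterE (N : nat) (w y : int) (c : nat) :
  (0 < N)%N -> coprimez w N ->
  supercharacter N w y =
  \sum_(0 <= i < ordmod N w) add_char N (w ^+ (c + i) * y).
Proof.
move=> N_gt0 wN; pose F i := add_char N (w ^+ i * y).
have FD i : F (i + ordmod N w)%N = F i.
  by apply: eq_add_char; rewrite // -modzMml expzD_ordmod // modzMml.
rewrite (sum_periodic_shift c FD) -(sum_periodic_shift 1 FD).
by rewrite /Defs.supercharacter big_add1.
Qed.

Lemma eq_supercharacter (N : nat) (w w' y y' : int) : (0 < N)%N ->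
  (w = w' %[mod N])%Z -> (y = y' %[mod N])%Z ->
  supercharacter N w y = supercharacter N w' y'.
Proof.
move=> N_gt0 ww' yy'; rewrite /Defs.supercharacter (eq_ordmod ww').
apply: eq_bigr => j _; apply: eq_add_char => //.
by rewrite -modzMm -modzXm ww' yy' modzXm modzMm.
Qed.

Lemma supercharacterN (N : nat) (w y : int) :
  supercharacter N w (- y) = (supercharacter N w y)^*.
Proof.
rewrite [RHS]raddf_sum; apply: eq_bigr => j _.
by rewrite mulrN; exact: add_charN.
Qed.

Lemma supercharacter_orbit (N a : nat) (w y : int) :
  (0 < N)%N -> coprimez w N ->
  supercharacter N w (w ^+ a * y) = supercharacter N w y.
Proof.
move=> N_gt0 wN; rewrite [RHS](supercharacterE y a) //.
rewrite (supercharacterE _ 0) //; apply: eq_bigr => i _.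
by rewrite mulrA -exprD addnC.
Qed.

(** The order of w mod p n is lcm (a k, a b) = a (b k). For each residue j of
    the exponent mod a, the sum over the remaining b k exponents separates. *)
Lemma supercharacter_mul (p n a b k : nat) (w s t : int) :
  (0 < p)%N -> (0 < n)%N -> coprime p n -> coprimez w (p * n)%N ->
  (0 < a)%N -> coprime b k ->
  ordmod n w = (a * b)%N -> ordmod p w = (a * k)%N ->
  supercharacter (p * n) w (s * p%:Z + t * n%:Z) =
  \sum_(1 <= j < a.+1)
    supercharacter n (w ^+ a) (w ^+ j * s) *
    supercharacter p (w ^+ a) (w ^+ j * t).
Proof.
move=> p_gt0 n_gt0 pn wpn a_gt0 bk ord_n ord_p.
have /andP[wp wn] : coprimez w p && coprimez w n by rewrite -coprimezMr -PoszM.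
have ord_na := ordmodX n_gt0 wn a_gt0 ord_n.
have ord_pa := ordmodX p_gt0 wp a_gt0 ord_p.
have ord_pn : ordmod (p * n) w = (a * (b * k))%N.
  rewrite ordmod_lcm // ord_n ord_p -muln_lcmr lcmnC; congr (_ * _)%N.
  by rewrite -[LHS]muln1 -(eqP bk) muln_lcm_gcd.
rewrite (supercharacterE _ 1) ?muln_gt0 ?p_gt0 // ord_pn sum_by_residue.
rewrite big_add1 /=; apply: eq_bigr => j _.
rewrite !(supercharacterE _ 0) ?coprimezX // ord_na ord_pa.
rewrite -sum_periodic_mul //.
- apply: eq_bigr => m _; rewrite add_char_crt //.
  by rewrite add0n !mulrA -!exprM -!exprD addnA add1n addnC.
- move=> i; apply: eq_add_char => //; rewrite -modzMml addnA -ord_na.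
  by rewrite expzD_ordmod ?coprimezX // modzMml.
- move=> i; apply: eq_add_char => //; rewrite -modzMml addnA -ord_pa.
  by rewrite expzD_ordmod ?coprimezX // modzMml.
Qed.

(** <w^(2h)> has index 2 in <w^h>, and w^h represents the other coset. *)
Lemma supercharacter_split2 (N h b : nat) (w y : int) :
  (0 < N)%N -> coprimez w N -> (0 < h)%N -> ordmod N w = (2 * h * b)%N ->
  supercharacter N (w ^+ h) y =
  supercharacter N (w ^+ (2 * h)) y +
  supercharacter N (w ^+ (2 * h)) (w ^+ h * y).
Proof.
move=> N_gt0 wN h_gt0 ord_w.
have ord_wh : ordmod N (w ^+ h) = (2 * b)%N.
  by apply: ordmodX => //; rewrite mulnCA mulnA.
have ord_w2h : ordmod N (w ^+ (2 * h)) = b.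
  by apply: ordmodX => //; rewrite muln_gt0.
rewrite (supercharacterE _ 0) ?coprimezX // ord_wh sum_by_residue.
rewrite big_nat_recl // big_nat1; congr (_ + _);
  rewrite (supercharacterE _ 0) ?coprimezX // ord_w2h;
  apply: eq_bigr => i _.
- by rewrite -!exprM mulnCA mulnA.
- rewrite add0n mulrA -!exprM -exprD mulnDr muln1 addnC mulnA.
  by rewrite [(h * 2)%N]mulnC.
Qed.

(** As v is odd, h v = h + 2h (v - 1) / 2: up to a power of w^(2h), which moves
    y inside its orbit, w^h equals w^(h v) = -1. *)
Lemma supercharacter_half_order (N h v : nat) (w y : int) :
  (0 < N)%N -> coprimez w N -> odd v -> (w ^+ (h * v) = -1 %[mod N])%Z ->
  supercharacter N (w ^+ (2 * h)) (w ^+ h * y) =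
  (supercharacter N (w ^+ (2 * h)) y)^*.
Proof.
move=> N_gt0 wN v_odd w_half.
rewrite -(supercharacter_orbit v./2 (_ * y)) ?coprimezX // -supercharacterN.
apply: eq_supercharacter => //; rewrite mulrA -exprM -exprD.
have -> : (2 * h * v./2 + h = h * v)%N.
  by rewrite -[v in RHS]odd_double_half v_odd mulnDr muln1 addnC mulnAC -mul2n
    mulnC.
by rewrite -modzMml w_half modzMml mulN1r.
Qed.

Lemma ordmod_prim_root (p : nat) (w : int) : prime p -> coprimez w p ->
  (ordmod p w).-primitive_root (w%:~R : 'F_p).
Proof.
move=> p_pr wp; have p_gt0 := prime_gt0 p_pr.
have ordP m : (ordmod p w %| m)%N = ((w%:~R : 'F_p) ^+ m == 1).
  rewrite ordmod_dvdn // eqz_mod_dvd (dvdz_pcharf (pchar_Fp p_pr)).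
  by rewrite intrB subr_eq0 rmorphXn.
have /eqP/(prim_order_exists (ordmod_gt0 p_gt0 wp))[m mw _] :
  (w%:~R : 'F_p) ^+ ordmod p w == 1 by rewrite -ordP.
suff -> : ordmod p w = m by [].
by apply/eqP; rewrite eqn_dvd ordP (prim_expr_order mw) eqxx (prim_order_dvd mw)
  -ordP dvdnn.
Qed.

(** The sum over residues j mod p is a sum over the field 'F_p. The residue 0
    contributes 1, and j -> j ^ K covers each power of h exactly K times. *)
Lemma gauss_supercharacter (p K k : nat) (h t : int) :
  prime p -> coprimez h p -> ordmod p h = k -> p.-1 = (K * k)%N ->
  gauss R p K t = 1 + K%:R * supercharacter p h t.
Proof.
move=> p_pr hp ord_h pKk; have p_gt0 := prime_gt0 p_pr.
have K_gt0 : (0 < K)%N.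
  by have := prime_gt1 p_pr; rewrite -subn_gt0 subn1 pKk muln_gt0 => /andP[].
(* The character x -> e(t x / p) on 'F_p, through representatives. *)
pose psi (x : 'F_p) := add_char p (t * (x : nat)%:Z).
have psiE m : add_char p (t * m) = psi m%:~R.
  apply: eq_add_char => //; rewrite -modzMmr -[RHS]modzMmr.
  congr ((_ * _) %% _)%Z.
  apply/eqP; rewrite eqz_mod_dvd (dvdz_pcharf (pchar_Fp p_pr)) intrB -pmulrn.
  by rewrite natr_Zp subrr.
have -> : gauss R p K t = \sum_(x : 'F_p) psi (x ^+ K).
  pose G i := psi (i%:R ^+ K).
  transitivity (\sum_(0 <= i < p) G i).
    rewrite -(sum_periodic_shift 1) => [|i]; last first.
      by rewrite /G natrD (pchar_Fp_0 p_pr) addr0.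
    rewrite /gauss big_add1 /=; apply: eq_bigr => j _.
    by rewrite -[LHS]/(add_char p _) psiE rmorphXn /= -pmulrn add1n.
  rewrite -[X in index_iota _ X](Fp_cast p_pr) big_mkord; apply: eq_bigr => x _.
  by rewrite /G natr_Zp.
rewrite (bigD1 0) //= expr0n (gtn_eqF K_gt0).
have <- : add_char p (t * 0) = psi 0 by exact: psiE.
rewrite mulr0 /(add_char _ _) mul0r e0; congr (_ + _).
have hk := ordmod_prim_root p_pr hp; rewrite ord_h in hk.
have card_Kk : #|'F_p|.-1 = (K * k)%N by rewrite card_Fp.
rewrite (sum_finField_powers psi card_Kk hk) mulr_natl; congr (_ *+ _).
rewrite (supercharacterE _ 0) // ord_h; apply: eq_bigr => l _.
by rewrite mulrC psiE rmorphXn.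
Qed.

End Supercharacter.

(** * Assembling the formulas *)

(** If p divides n, the congruence w^(h v) = -1 descends to p. There -1 <> 1, so
    ord_p(w) = h m divides 2 h v but not h v. Since it is coprime to v, m
    divides 2 but not 1. *)
Lemma coprime_of_half_order (p n h v m : nat) (w : int) :
  prime p -> odd p -> (0 < n)%N -> coprimez w p -> (0 < h)%N ->
  (w ^+ (h * v) = -1 %[mod n])%Z ->
  ordmod p w = (h * m)%N -> coprime v (ordmod p w) -> m != 2%N ->
  coprime p n.
Proof.
move=> p_pr p_odd n_gt0 wp h_gt0 w_half ord_p v_ord m_neq2.
have p_gt0 := prime_gt0 p_pr.
rewrite prime_coprime //; apply: contra m_neq2 => p_n.
have w_half_p : (w ^+ (h * v) = -1 %[mod p])%Z.
  apply/eqP; rewrite eqz_mod_dvd; apply: (@dvdz_trans n) => //.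
  by rewrite -eqz_mod_dvd; apply/eqP.
have : (ordmod p w %| 2 * h)%N.
  rewrite -(@Gauss_dvdl _ _ v) 1?coprime_sym // ordmod_dvdn //.
  by rewrite -mulnA mulnC exprM -modzXm w_half_p modzXm sqrrN expr1n.
have : ~~ (ordmod p w %| h * v)%N.
  rewrite ordmod_dvdn // w_half_p eqz_mod_dvd.
  apply: contraL p_odd => /(dvdn_leq (isT : (0 < 2)%N)) p_le2.
  by have -> : p = 2%N by apply/eqP; rewrite eqn_leq p_le2 prime_gt1.
rewrite ord_p [(2 * h)%N]mulnC !dvdn_pmul2l // => m_v.
case/primeP: (isT : prime 2) => _ dvd2 /dvd2/orP[]/eqP m1; last by rewrite m1.
by rewrite m1 dvd1n in m_v.
Qed.

Lemma mxact_mx2 (R : realType) (a b c d z : R[i]) :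
  mxact (mx2 a b c d) z =
  (a * (complex.Re z)%:C + b * (complex.Im z)%:C)
  + 'i%C * (c * (complex.Re z)%:C + d * (complex.Im z)%:C).
Proof. by rewrite /mxact !mxE. Qed.

Lemma conjc_ReIm (R : realType) (z : R[i]) :
  z^* = (complex.Re z)%:C - 'i%C * (complex.Im z)%:C.
Proof. by apply: (addrI z); rewrite addcJ {2}[z]complexE; ring. Qed.

Theorem theorem3p7 (R : realType) (p n : nat) (w wp wn : int) (u v r : nat)
    (s t : int)
    (p_prime : prime p) (p_odd : odd p) (n_gt0 : (0 < n)%N)
    (w_unit : coprimez w (p * n)%N)
    (wpE : (wp = w %[mod p])%Z) (wnE : (wn = w %[mod n])%Z)
    (u_gt0 : (0 < u)%N) (v_gt0 : (0 < v)%N)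
    (ord_wn : ordmod n wn = (u * v)%N)
    (u_even : ~~ odd u) (v_odd : odd v)
    (v_coprime : gcdn v (ordmod p wp) = 1%N)
    (r_gt0 : (0 < r)%N)
    (wn_half : (wn ^+ ((u * v) %/ 2) = -1 %[mod n])%Z)
    (ord_wp : (ordmod p wp)%:R = r%:R^-1 * (totient p)%:R :> rat)
    (t_coprime : gcdz t p = 1) :
  ((p = 1 %[mod 2 * r * u])%N ->
    supercharacter R (p * n) w (s * p%:Z + t * n%:Z) =
    2 / (r * u)%:R *
    \sum_(1 <= j < (u %/ 2).+1)
      mxact (mx2 (gauss R p ((r * u) %/ 2) (w ^+ j * t) - 1) 0
                 0 (gauss R p (r * u) (w ^+ j * t)
                    - gauss R p ((r * u) %/ 2) (w ^+ j * t)))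
            (supercharacter R n (wn ^+ u) (w ^+ j * s)))
  /\
  ((4 %| u)%N -> (p = 1 + (r * u) %/ 2 %[mod r * u])%N ->
    supercharacter R (p * n) w (s * p%:Z + t * n%:Z) =
    4 / (r * u)%:R *
    \sum_(1 <= j < (u %/ 2).+1)
      mxact (mx2 ((complex.Re (gauss R p ((r * u) %/ 2) (w ^+ j * t)))%:C - 1) 0
                 (complex.Im (gauss R p ((r * u) %/ 2) (w ^+ j * t)))%:C 0)
            (supercharacter R n (wn ^+ u) (w ^+ j * s))).
Proof.
have p_gt0 := prime_gt0 p_prime.
have /andP[wp_unit wn_unit] : coprimez w p && coprimez w n.
  by rewrite -coprimezMr -PoszM.
rewrite (eq_ordmod wpE) in v_coprime ord_wp; rewrite (eq_ordmod wnE) in ord_wn.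
have {ord_wp} p_pred : p.-1 = (r * ordmod p w)%N.
  apply/eqP; rewrite -(eqr_nat rat) natrM ord_wp mulrA divff ?mul1r.
    by rewrite totient_prime.
  by rewrite pnatr_eq0 -lt0n.
have v_ord : coprime v (ordmod p w) by apply/eqP.
have {wn_half} w_half : (w ^+ ((u * v) %/ 2) = -1 %[mod n])%Z.
  by rewrite -modzXm -wnE modzXm.
have [h uE] : exists h, u = (2 * h)%N.
  by exists u./2; rewrite mul2n even_halfK.
have h_gt0 : (0 < h)%N by move: u_gt0; rewrite uE muln_gt0.
rewrite uE in ord_wn w_half *.
rewrite -mulnA mulKn // in w_half.
have -> : ((r * (2 * h)) %/ 2 = r * h)%N by rewrite mulnCA mulKn.
rewrite mulKn //.
have sc_wn y : supercharacter R n (wn ^+ (2 * h)) y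
             = supercharacter R n (w ^+ (2 * h)) y.
  by apply: eq_supercharacter; rewrite // -modzXm wnE modzXm.
have r_neq0 : r%:R != 0 :> R[i] by rewrite pnatr_eq0 -lt0n.
have h_neq0 : h%:R != 0 :> R[i] by rewrite pnatr_eq0 -lt0n.
have gaussE a k y : (0 < a)%N -> ordmod p w = (a * k)%N ->
  gauss R p (r * a) y = 1 + (r * a)%:R * supercharacter R p (w ^+ a) y.
  move=> a_gt0 ord_w; apply: (@gauss_supercharacter R p _ k) => //.
  - exact: coprimezX.
  - exact: ordmodX ord_w.
  - by rewrite p_pred ord_w mulnA.
split=> [|_] p_mod.
- have [m ord_wp] : exists m, ordmod p w = (2 * h * (2 * m))%N.
    have : (2 * r * (2 * h) %| p - 1)%N by rewrite -eqn_mod_dvd //; apply/eqP.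
    have -> : (2 * r * (2 * h) = r * (2 * h * 2))%N.
      by rewrite [(2 * r)%N]mulnC -mulnA [(2 * (2 * h))%N]mulnC.
    rewrite subn1 p_pred dvdn_pmul2l // => /dvdnP[m ->].
    by exists m; rewrite mulnC mulnA.
  have ord_wp_h : ordmod p w = (h * (2 * (2 * m)))%N.
    by rewrite ord_wp -mulnA mulnCA.
  have pn : coprime p n.
    apply: (coprime_of_half_order p_prime p_odd n_gt0 wp_unit h_gt0 w_half
      ord_wp_h v_ord).
    by case: (m) => // m'; rewrite !mulnS.
  have v_m : coprime v (2 * m).
    by move: v_ord; rewrite ord_wp coprimeMr => /andP[].
  rewrite (supercharacter_mul R s t p_gt0 n_gt0 pn w_unit
    (a := 2 * h) _ v_m) //; last by rewrite muln_gt0.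
  (* Pair the term j <= h with the term j + h. *)
  rewrite (big_cat_nat (n := h.+1)) //=; last by rewrite ltnS leq_pmull.
  rewrite -{2}(add1n h) big_addn.
  have -> : ((2 * h).+1 - h = h.+1)%N by rewrite mul2n -addnn -addSn addnK.
  rewrite -big_split /= mulr_sumr; apply: eq_bigr => j _.
  rewrite sc_wn.
  have shift (y : int) : w ^+ (j + h) * y = w ^+ h * (w ^+ j * y).
    by rewrite mulrA -exprD addnC.
  rewrite !shift.
  have -> :=
    supercharacter_half_order R (w ^+ j * s) n_gt0 wn_unit v_odd w_half.
  have h2_gt0 : (0 < 2 * h)%N by rewrite muln_gt0.
  rewrite (gaussE _ _ _ h_gt0 ord_wp_h) (gaussE _ _ _ h2_gt0 ord_wp).
  rewrite (supercharacter_split2 R _ p_gt0 wp_unit h_gt0 ord_wp) mxact_mx2.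
  set Z := supercharacter R n _ _; rewrite conjc_ReIm [Z in Z * _]complexE.
  rewrite !natrM.
  by field; rewrite r_neq0 h_neq0.
- have [k k_odd ord_wp] : exists2 k, odd k & ordmod p w = (h * k)%N.
    have : (r * (ordmod p w %% (2 * h)) == r * h)%N.
      rewrite muln_modr -p_pred.
      have : (p.-1 == r * h %[mod r * (2 * h)])%N.
        by rewrite -(eqn_modDl 1) add1n prednK //; apply/eqP.
      move/eqP ->; rewrite -muln_modr modn_small //.
      by rewrite ltn_Pmull.
    rewrite eqn_pmul2l // => /eqP ord_mod.
    exists (ordmod p w %/ (2 * h) * 2).+1; first by rewrite /= muln2 odd_double.
    rewrite {1}(divn_eq (ordmod p w) (2 * h)) ord_mod mulnS addnC.
    by rewrite [(2 * h)%N]mulnC mulnCA.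
  have pn : coprime p n.
    apply: (coprime_of_half_order p_prime p_odd n_gt0 wp_unit h_gt0 w_half
      ord_wp v_ord).
    by apply: contraTneq k_odd => ->.
  have v2_k : coprime (2 * v) k.
    rewrite coprimeMl coprime2n k_odd /=.
    by move: v_ord; rewrite ord_wp coprimeMr => /andP[].
  have ord_wn_h : ordmod n w = (h * (2 * v))%N by rewrite ord_wn mulnCA mulnA.
  rewrite (supercharacter_mul R s t p_gt0 n_gt0 pn w_unit h_gt0 v2_k) //.
  rewrite mulr_sumr; apply: eq_bigr => j _.
  rewrite sc_wn.
  rewrite (supercharacter_split2 R _ n_gt0 wn_unit h_gt0 ord_wn).
  have -> :=
    supercharacter_half_order R (w ^+ j * s) n_gt0 wn_unit v_odd w_half.
  rewrite mxact_mx2.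
  (* The matrix contains G only through its real and imaginary parts: eliminate
     the real part by the equation for G. *)
  have := gaussE _ _ (w ^+ j * t) h_gt0 ord_wp.
  set G := gauss _ _ _ _; rewrite [G in G = _]complexE.
  move=> /(canRL (addrK _)) ->.
  set Z := supercharacter R n _ _; rewrite conjc_ReIm [Z in Z + _]complexE.
  rewrite !natrM.
  by field; rewrite r_neq0 h_neq0.
Qed.
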